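(* Let $(\mathfrak h,(H_i,L_i)_{i\in I})$ be a linear Coxeter system with linear Coxeter group $\mathcal W$, closed fundamental chamber $\overline C$ and Tits cone $X$. Let $Y\subseteq X$ be a $\mathcal W$-invariant convex subcone containing $0$. If $\mathcal W$ acts faithfully on $Y$, and $Y\cap\overline C$ is closed, then we have $-Z^\vee\subseteq Y$.
   Context: $\mathbb R^+_0=[0,\infty)$, $\mathbb R^+=(0,\infty)$. A convex cone is a subset of a real vector space closed under addition and under multiplication by elements of $\mathbb R^+$. Linear Coxeter systems. Let $\mathfrak h$ be a finite-dimensional real vector space, $n\ge1$, $I=\{1,\dots,n\}$. For a zero-based closed ray $H\subseteq\mathfrak h$ put $H^{\ge0}=\{\lambda\in\mathfrak h^*\mid\lambda(h)\ge0\ \forall h\in H\}$, $H^{>0}=\{\lambda\mid\lambda(h)>0\ \forall h\in H\setminus\{0\}\}$, $H^{=0}=\{\lambda\mid\lambda(h)=0\ \forall h\in H\}$. A linear Coxeter system $(\mathfrak h,(H_i,L_i)_{i\in I})$ consists of zero-based closed rays $H_i\subseteq\mathfrak h$, $L_i\subseteq\mathfrak h^*$ with $L_i\setminus\{0\}\subseteq H_i^{>0}$ such that: (1) the closed fundamental chamber $\overline C=\bigcap_{i\in I}H_i^{\ge0}$ spans $\mathfrak h^*$, and $\overline C\cap H_i^{=0}$, $i\in I$, are its pairwise different faces of codimension 1; (2) with $C=\bigcap_{i\in I}H_i^{>0}$ and $\mathcal W$ (the linear Coxeter group) the group generated by the reflections $\sigma_i$ on $\mathfrak h^*$ at the hyperplane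 $H_i^{=0}$ along the line $L_i\cup(-L_i)$, one has $\sigma C\cap C=\emptyset$ for all $\sigma\in\mathcal W\setminus\{1\}$. The Tits cone is the convex cone $X=\bigcup_{\sigma\in\mathcal W}\sigma\overline C$. For each $i$ fix $h_i\in H_i$, $\alpha_i\in L_i$ with $\alpha_i(h_i)=2$ (nothing below depends on the choice). The dual imaginary cone is $Z^\vee=\bigcup_{\sigma\in\mathcal W}\sigma K^\vee\subseteq\mathfrak h^*$, where $K^\vee=\big(\sum_{i\in I}\mathbb R_0^+\alpha_i\big)\cap(-\overline C)$. *)

(* Defs.v *)
From HB Require Import structures.
From mathcomp Require Import all_boot all_order all_algebra.
From mathcomp Require Import all_classical all_reals all_analysis.

Set Implicit Arguments.
Unset Strict Implicit.
Unset Printing Implicit Defensive.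

Import Order.TTheory GRing.Theory Num.Theory.
Import numFieldNormedType.Exports.

Local Open Scope classical_set_scope.
Local Open Scope ring_scope.

Section RealVectorSpaces.
Variables (R : realType) (V : vectType R).
Implicit Types (A C F : set V) (U : {vspace V}).

Definition is_ray A : Prop :=
  exists2 v : V, v != 0 & A = [set t *: v | t in [set t : R | 0 <= t]].

Definition convex_cone A : Prop :=
  (forall x y, A x -> A y -> A (x + y)) /\
  (forall (t : R) x, 0 < t -> A x -> A (t *: x)).

Definition is_linear_span A U : Prop :=
  (forall x, A x -> x \in U) /\
  (forall U', (forall x, A x -> x \in U') -> (U <= U')%VS).

(* Faces are nonempty: the span of the empty set is 0, so that the empty set
   would otherwise count as a face of codimension 1 when \dim V = 1. *)
Record is_face C F : Prop := IsFace {
  face_neq0 : F !=set0;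
  face_sub : F `<=` C;
  face_cone : convex_cone F;
  face_extreme : forall x y, C x -> C y -> F (x + y) -> F x /\ F y }.

(* Only used for a cone [C] that spans [V], so that the codimension of [F] in
   [C] is its codimension in [V]. *)
Definition is_facet C F : Prop :=
  is_face C F /\ exists2 U, is_linear_span F U & (\dim U).+1 = \dim {:V}.

(* The topology of a finite-dimensional real vector space, transported from
   row vectors by the coordinates in a basis. *)
Definition closed_in_vect A : Prop :=
  closed [set \row_i coord (vbasis {:V}) i x | x in A].

Inductive generated_group (S : set 'End(V)) : set 'End(V) :=
| generated_id : generated_group S \1%VF
| generated_gen s : S s -> generated_group S s
| generated_comp s t :
    generated_group S s -> generated_group S t -> generated_group S (s \o t)%VF
| generated_inv s : generated_group S s -> generated_group S (s^-1)%VF.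

End RealVectorSpaces.

Section LinearCoxeterSystems.
Variables (R : realType) (h : vectType R).
Local Notation dual := 'Hom(h, R^o).

Definition dual_ge0 (H : set h) : set dual :=
  [set l | forall x, H x -> (0 : R) <= l x].

Definition dual_gt0 (H : set h) : set dual :=
  [set l | forall x, H x -> x != 0 -> (0 : R) < l x].

Definition dual_eq0 (H : set h) : set dual :=
  [set l | forall x, H x -> l x = 0].

Definition is_reflection (H : set h) (L : set dual) (s : 'End(dual)) : Prop :=
  (forall l, dual_eq0 H l -> s l = l) /\ (forall l, L l -> s l = - l).

Variables (n : nat) (H : 'I_n -> set h) (L : 'I_n -> set dual).

Definition closed_chamber : set dual := \bigcap_i dual_ge0 (H i).

Definition open_chamber : set dual := \bigcap_i dual_gt0 (H i).

Definition coxeter_group : set 'End(dual) :=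
  generated_group [set s | exists i, is_reflection (H i) (L i) s].

Definition wall (i : 'I_n) : set dual := closed_chamber `&` dual_eq0 (H i).

Record linear_coxeter_system : Prop := LinearCoxeterSystem {
  lcs_rank : (0 < n)%N;
  lcs_rayH : forall i, is_ray (H i);
  lcs_rayL : forall i, is_ray (L i);
  lcs_pos : forall i, L i `\ 0 `<=` dual_gt0 (H i);
  lcs_span : is_linear_span closed_chamber fullv;
  lcs_facets : range wall = is_facet closed_chamber;
  lcs_wall_inj : injective wall;
  lcs_disj : forall s, coxeter_group s -> s <> \1%VF ->
    (s @` open_chamber) `&` open_chamber = set0 }.

Definition tits_cone : set dual :=
  \bigcup_(s in coxeter_group) (s @` closed_chamber).

Definition dual_imaginary_base (alpha : 'I_n -> dual) : set dual :=
  [set l | exists2 c : 'I_n -> R,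
     (forall i, 0 <= c i) & l = \sum_i c i *: alpha i] `&`
  [set - l | l in closed_chamber].

Definition dual_imaginary_cone (alpha : 'I_n -> dual) : set dual :=
  \bigcup_(s in coxeter_group) (s @` dual_imaginary_base alpha).

End LinearCoxeterSystems.

(* Main.v *)
(* Off the diagonal alpha_k(h_i) <= 0. Together with faithfulness this yields a
   point y of Y in the open fundamental chamber: Y contains the segment from y
   to sigma_i y, so positivity on some h_i propagates to the neighbours of i, and
   the indices that are never reached would act trivially on Y.

   Let l = - sum_i c_i alpha_i be in the closed chamber with c_i >= 0. Scale y such
   that y(h_i) >= n c_i. Then y + l is the average over i of the points
   y - n c_i alpha_i of Y, and (y + l)(h_i) >= y(h_i), so that the step can be
   repeated: y + k l lies in Y and in the closed chamber for every k, and
   (y + k l) / k tends to l. *)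

Require Import Defs.
From HB Require Import structures.
From mathcomp Require Import all_boot all_order all_algebra.
From mathcomp Require Import all_classical all_reals all_analysis.
From mathcomp Require Import ring lra.

Import Order.TTheory GRing.Theory Num.Theory.
Import numFieldNormedType.Exports.

Set Implicit Arguments.
Unset Strict Implicit.
Unset Printing Implicit Defensive.

Local Open Scope classical_set_scope.
Local Open Scope ring_scope.

(** * Convex cones, limits along a half-line, and rays *)

Section ConvexCones.
Variables (R : realType) (V : vectType R) (Y : set V).
Hypotheses (Y_cone : convex_cone Y) (Y_0 : Y 0).

Lemma cone_add x y : Y x -> Y y -> Y (x + y).
Proof. exact: Y_cone.1. Qed.

Lemma cone_scale (t : R) x : 0 <= t -> Y x -> Y (t *: x).
Proof.
rewrite le_eqVlt => /orP[/eqP <- _|t0 Yx]; first by rewrite scale0r.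
exact: Y_cone.2.
Qed.

Lemma cone_sum (I : finType) (f : I -> V) :
  (forall i, Y (f i)) -> Y (\sum_i f i).
Proof. by move=> Yf; apply: big_ind => //; exact: cone_add. Qed.

(** The coordinates of x / (k + 1) + y converge to those of y, and the coordinate map is
    injective. *)
Lemma closed_in_vect_halfline (A : set V) (x y : V) :
  closed_in_vect A -> (forall k, A (k.+1%:R^-1 *: x + y)) -> A y.
Proof.
rewrite /closed_in_vect; set f := fun v => \row__ _ => clA Axy.
have [z Az fz] : [set f v | v in A] (f y).
  apply: (@closed_cvg _ _ \oo _ (fun k => (harmonic k : R) *: f x + f y) _ clA).
    apply: nearW => k; exists (k.+1%:R^-1 *: x + y) => //.
    by apply/rowP => i; rewrite !mxE linearD linearZ.
  rewrite -[X in _ --> X]add0r -[in X in _ --> X](scale0r (f x)).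
  apply: cvgD; last exact: cvg_cst.
  by apply: cvgZr_tmp; exact: cvg_harmonic.
suff -> : y = z by [].
rewrite (coord_vbasis (memvf y)) (coord_vbasis (memvf z)).
by apply: eq_bigr => i _; move/rowP: fz => /(_ i); rewrite !mxE => ->.
Qed.

End ConvexCones.

(** This lets the chosen [hv i] and [alpha i] replace the unknown generators of the rays. *)
Lemma ray_mem (R : realType) (V : vectType R) (A : set V) (v : V) :
  is_ray A -> A v -> v != 0 -> A = [set t *: v | t in [set t : R | 0 <= t]].
Proof.
move=> [w w0 ->] [t /= t0 <-] tw0.
have {}t0 : 0 < t by rewrite lt_def t0 andbT; apply: contra tw0 => /eqP->; rewrite scale0r.
apply/seteqP; split=> _ [s /= s0 <-].
  by exists (s / t) => /=; [exact: divr_ge0 s0 (ltW t0)|rewrite scalerA divfK// gt_eqF].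
by exists (s * t) => /=; [exact: mulr_ge0 s0 (ltW t0)|rewrite scalerA].
Qed.

(** * Evaluation at a vector as a linear form on the dual space *)

Section Evaluation.
Variables (R : realType) (h : vectType R) (x : h).
Implicit Types l m : 'Hom(h, R^o).

Definition ev l : R := l x.

Lemma evD l m : ev (l + m) = ev l + ev m.
Proof. by rewrite /ev add_lfunE. Qed.

Lemma evN l : ev (- l) = - ev l.
Proof. by rewrite /ev opp_lfunE. Qed.

Lemma evB l m : ev (l - m) = ev l - ev m.
Proof. by rewrite evD evN. Qed.

Lemma evZ (t : R) l : ev (t *: l) = t * ev l.
Proof. by rewrite /ev scale_lfunE. Qed.

Lemma ev_sum (I : finType) (f : I -> 'Hom(h, R^o)) :
  ev (\sum_i f i) = \sum_i ev (f i).
Proof. by rewrite /ev sum_lfunE. Qed.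

Definition ev_regular l : R^o := ev l.

Lemma ev_regular_is_linear : linear ev_regular.
Proof. by move=> a l m; rewrite /ev_regular evD evZ. Qed.

HB.instance Definition _ :=
  GRing.isLinear.Build R 'Hom(h, R^o) R^o _ ev_regular ev_regular_is_linear.

(** A [vspace], so that the minimality of a linear span can be tested against it. *)
Definition annihilator : {vspace 'Hom(h, R^o)} := lker (linfun ev_regular).

Lemma mem_annihilator l : (l \in annihilator) = (ev l == 0).
Proof. by rewrite memv_ker lfunE. Qed.

End Evaluation.

(** * Chambers and reflections in terms of the chosen [hv] and [alpha] *)

Section CoxeterSystem.
Variables (R : realType) (h : vectType R) (n : nat).
Variables (H : 'I_n -> set h) (L : 'I_n -> set 'Hom(h, R^o)).
Hypothesis lcs : linear_coxeter_system H L.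
Variables (hv : 'I_n -> h) (alpha : 'I_n -> 'Hom(h, R^o)).
Hypotheses (hv_H : forall i, H i (hv i)) (alpha_L : forall i, L i (alpha i)).
Hypothesis alpha_hv : forall i, alpha i (hv i) = 2.
Local Notation dual := 'Hom(h, R^o).
Local Notation coroot i := (ev (hv i)).
Local Notation W := (coxeter_group H L).
Implicit Types (i j k : 'I_n) (l x y z : dual).

Lemma hv_neq0 i : hv i != 0.
Proof.
apply/eqP => hv0; have := alpha_hv i; rewrite hv0 linear0 => /eqP.
by rewrite eq_sym pnatr_eq0.
Qed.

Lemma alpha_neq0 i : alpha i != 0.
Proof.
apply/eqP => a0; have := alpha_hv i; rewrite a0 zero_lfunE => /eqP.
by rewrite eq_sym pnatr_eq0.
Qed.

Lemma rayHE i : H i = [set t *: hv i | t in [set t : R | 0 <= t]].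
Proof. exact: (ray_mem (lcs_rayH lcs i)) (hv_neq0 i). Qed.

Lemma rayLE i : L i = [set t *: alpha i | t in [set t : R | 0 <= t]].
Proof. exact: (ray_mem (lcs_rayL lcs i)) (alpha_neq0 i). Qed.

Lemma dual_ge0P i l : dual_ge0 (H i) l <-> 0 <= coroot i l.
Proof.
split=> [|l0 x]; first by apply.
by rewrite rayHE => -[t /= t0 <-]; rewrite linearZ /=; exact: mulr_ge0.
Qed.

Lemma dual_gt0P i l : dual_gt0 (H i) l <-> 0 < coroot i l.
Proof.
split=> [|l0 x]; first by apply => //; exact: hv_neq0.
rewrite rayHE => -[t /= t0 <-] tn0; rewrite linearZ; apply: mulr_gt0 => //.
by rewrite lt_def t0 andbT; apply: contra tn0 => /eqP->; rewrite scale0r.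
Qed.

Lemma dual_eq0P i l : dual_eq0 (H i) l <-> coroot i l = 0.
Proof.
split=> [|l0 x]; first by apply.
by rewrite rayHE => -[t /= t0 <-]; rewrite linearZ /= [l (hv i)]l0 scaler0.
Qed.

Lemma closed_chamberP l : closed_chamber H l <-> forall i, 0 <= coroot i l.
Proof.
by split=> [Cl i|Cl i _]; [apply/dual_ge0P; exact: Cl|exact/dual_ge0P].
Qed.

Lemma open_chamberP l : open_chamber H l <-> forall i, 0 < coroot i l.
Proof.
by split=> [Cl i|Cl i _]; [apply/dual_gt0P; exact: Cl|exact/dual_gt0P].
Qed.

Definition coroot_scale i l : dual := coroot i l *: alpha i.

Lemma coroot_scale_is_linear i : linear (coroot_scale i).
Proof. by move=> a l m; rewrite /coroot_scale evD evZ scalerDl scalerA. Qed.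

HB.instance Definition _ i := GRing.isLinear.Build R dual dual _ (coroot_scale i)
  (coroot_scale_is_linear i).

Definition reflection i : 'End(dual) := (\1 - linfun (coroot_scale i))%VF.

Lemma reflectionE i l : reflection i l = l - coroot i l *: alpha i.
Proof. by rewrite add_lfunE id_lfunE opp_lfunE lfunE. Qed.

Lemma coroot_alpha i : coroot i (alpha i) = 2.
Proof. exact: alpha_hv. Qed.

Lemma coroot_reflection k i l :
  coroot k (reflection i l) = coroot k l - coroot i l * coroot k (alpha i).
Proof. by rewrite reflectionE evB evZ. Qed.

Lemma reflection_is_reflection i : is_reflection (H i) (L i) (reflection i).
Proof.
split=> l; first by move=> /dual_eq0P l0; rewrite reflectionE l0 scale0r subr0.
rewrite rayLE => -[t _ <-].
rewrite reflectionE evZ coroot_alpha -scalerBl -[RHS]scaleNr; congr (_ *: _).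
ring.
Qed.

(** The values on the hyperplane and on the ray determine s: split l into l - (l(h_i)/2) alpha_i and
    (l(h_i)/2) alpha_i. *)
Lemma is_reflectionE i s : is_reflection (H i) (L i) s -> s = reflection i.
Proof.
move=> [s0 sN]; have [r0 rN] := reflection_is_reflection i.
apply/lfunP => l; rewrite -[l](subrK ((coroot i l / 2) *: alpha i)).
have : dual_eq0 (H i) (l - (coroot i l / 2) *: alpha i).
  by apply/dual_eq0P; rewrite evB evZ coroot_alpha; field.
move: (l - _) => m m0; rewrite 2!linearD 2!linearZ /=.
by rewrite (s0 _ m0) (r0 _ m0) (sN _ (alpha_L i)) (rN _ (alpha_L i)).
Qed.

(** * The group generated by the reflections *)

Lemma reflection_in i : W (reflection i).
Proof. by apply: generated_gen; exists i; exact: reflection_is_reflection. Qed.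

Lemma reflectionK i : involutive (reflection i).
Proof.
move=> l; rewrite [in LHS]reflectionE coroot_reflection coroot_alpha reflectionE.
by rewrite -addrA -opprD -scalerDl [X in X *: _](_ : _ = 0) ?scale0r ?subr0//; ring.
Qed.

Lemma reflection_neq1 i : reflection i <> \1%VF.
Proof.
move=> /lfunP/(_ (alpha i)); rewrite id_lfunE; have [_ ->//] := reflection_is_reflection i.
move=> /eqP; rewrite eq_sym -addr_eq0 -mulr2n -scaler_nat scaler_eq0.
by rewrite pnatr_eq0 (negPf (alpha_neq0 i)).
Qed.

(** Inversion is a total operation on endomorphisms; injectivity makes [s^-1] a genuine inverse. *)
Lemma coxeter_group_ker0 s : W s -> lker s == 0%VS.
Proof.
elim=> {s} [|s [i /is_reflectionE->]|s t _ ks _ kt|s _ ks].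
- by apply/lker0P => u v; rewrite !id_lfunE.
- by apply/lker0P; exact: inv_inj (@reflectionK i).
- apply/lker0P => u v; rewrite !comp_lfunE => /(lker0P ks); exact: (lker0P kt).
- by apply/lker0P; exact: can_inj (lker0_lfunVK ks).
Qed.

(** The equivalence, rather than one implication, carries the induction through inverses. *)
Lemma coxeter_group_stable (N : dual -> Prop) s :
  (forall i l, N l -> N (reflection i l)) -> W s -> forall l, N (s l) <-> N l.
Proof.
move=> NR; elim=> {s} [l|s [i /is_reflectionE->] l|s t _ Ns _ Nt l|s Ws Ns l].
- by rewrite id_lfunE.
- by split=> [/(NR i)|]; [rewrite reflectionK|exact: NR].
- by rewrite comp_lfunE Ns Nt.
- by rewrite -Ns lker0_lfunVK//; exact: coxeter_group_ker0.
Qed.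

(** * Points of the chamber and of its walls *)

Lemma closed_chamber_pos i : exists2 p, closed_chamber H p & 0 < coroot i p.
Proof.
apply: contrapT => noP; have [_ spanC] := lcs_span lcs.
(* Without such a point the chamber, hence its span, would lie in the annihilator of h_i, which
   misses alpha_i. *)
have /subvP/(_ (alpha i)) : (fullv <= annihilator (hv i))%VS.
  apply: spanC => p Cp; rewrite mem_annihilator.
  have := (closed_chamberP p).1 Cp i; rewrite le_eqVlt => /orP[/eqP p0|p0].
    by rewrite -p0.
  by case: noP; exists p.
by rewrite memvf mem_annihilator coroot_alpha pnatr_eq0 => /(_ isT).
Qed.

Lemma open_chamber_neq0 : exists p, open_chamber H p.
Proof.
have /choice[p pP] i : exists p, closed_chamber H p /\ 0 < coroot i p.
  by have [p] := closed_chamber_pos i; exists p.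
exists (\sum_i p i); apply/open_chamberP => i; rewrite ev_sum (bigD1 i)//=.
apply: ltr_wpDr; last exact: (pP i).2.
by apply: sumr_ge0 => k _; exact: (closed_chamberP _).1 (pP k).1 i.
Qed.

(** Both walls span subspaces of codimension 1, so an inclusion forces equal spans; h_i then
    vanishes on wall j as well, and the walls coincide. *)
Lemma wall_subP i j : wall H i `<=` wall H j -> i = j.
Proof.
move=> sub; apply: (lcs_wall_inj lcs); apply/seteqP; split=> //.
have facet k : is_facet (closed_chamber H) (wall H k).
  by rewrite -(lcs_facets lcs); exists k.
have [_ [Ui [inUi minUi] dimUi]] := facet i.
have [_ [Uj [inUj minUj] dimUj]] := facet j.
have Uij : Ui = Uj.
  apply/eqP; rewrite eqEdim -ltnS dimUi -dimUj leqnn andbT.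
  by apply: minUi => x /sub; exact: inUj.
have /subvP Ui0 : (Ui <= annihilator (hv i))%VS.
  by apply: minUi => x [_ /dual_eq0P x0]; rewrite mem_annihilator; exact/eqP.
move=> x wx; split; first by case: wx.
by apply/dual_eq0P/eqP; rewrite -mem_annihilator Ui0// Uij inUj.
Qed.

Lemma wall_pos i j : i != j ->
  exists p, [/\ closed_chamber H p, coroot i p = 0 & 0 < coroot j p].
Proof.
move=> neq; apply: contrapT => noP; case/eqP: neq; apply: wall_subP => p [Cp /dual_eq0P p0].
split=> //; apply/dual_eq0P/eqP; rewrite eq_le (closed_chamberP p).1// andbT.
by rewrite leNgt; apply/negP => pj; apply: noP; exists p.
Qed.

(* Otherwise [coroot k - alpha_i(h_k) coroot i] changes sign on the chamber, hence
   vanishes at a point of it, which is fixed by the reflection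
   [sigma_i sigma_k sigma_i]. *)
Lemma coroot_alpha_le0 i k : i != k -> coroot k (alpha i) <= 0.
Proof.
move=> neq; rewrite leNgt; apply/negP; set b : R := coroot k (alpha i) => b0.
have [c /open_chamberP Cc] := open_chamber_neq0.
have [p [/closed_chamberP Cp pi pk]] := wall_pos neq.
have [q [/closed_chamberP Cq qk qi]] : exists p, [/\ closed_chamber H p, coroot k p = 0 &
  0 < coroot i p] by apply: wall_pos; rewrite eq_sym.
pose f (l : dual) : R := coroot k l - b * coroot i l.
have fD l m : f (l + m) = f l + f m by rewrite /f !evD; ring.
have fZ (t : R) l : f (t *: l) = t * f l by rewrite /f !evZ; ring.
have fp : 0 < f p by rewrite /f pi mulr0 subr0.
have fq : f q < 0 by rewrite /f qk sub0r oppr_lt0 mulr_gt0.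
have pos (t : R) m : 0 <= t -> (forall j, 0 <= coroot j m) ->
    open_chamber H (c + t *: m).
  move=> t0 m0; apply/open_chamberP => j; rewrite evD evZ.
  by apply: ltr_wpDr (Cc j); exact: mulr_ge0.
(* Start from an interior point c and add the nonnegative multiple of q or p that cancels f(c); the
   sum stays interior. *)
have [z Cz fz] : exists2 z, open_chamber H z & f z = 0.
  have [fc|fc] := leP 0 (f c).
    exists (c + (f c / - f q) *: q); first by apply: pos => //; apply: divr_ge0; lra.
    by rewrite fD fZ; field; lra.
  exists (c + (- f c / f p) *: p); first by apply: pos => //; apply: divr_ge0; lra.
  by rewrite fD fZ; field; lra.
pose r := (reflection i \o (reflection k \o reflection i))%VF.
have rz : r z = z.
  (* The value of h_k at sigma_i z is f(z) = 0, so sigma_k fixes sigma_i z. *)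
  rewrite !comp_lfunE (reflectionE k) coroot_reflection [X in X *: _](_ : _ = 0).
    by rewrite scale0r subr0 reflectionK.
  by move: fz; rewrite /f -/b mulrC.
have r1 : r <> \1%VF.
  move=> r1; apply: (@reflection_neq1 k); apply/lfunP => l; move/lfunP: r1 => /(_ (reflection i l)).
  by rewrite !comp_lfunE !id_lfunE reflectionK => /(can_inj (@reflectionK i)).
have Wr : W r by do 2?apply: generated_comp; exact: reflection_in.
have /seteqP[/(_ z) + _] := lcs_disj lcs Wr r1.
by case; split=> //; exists z.
Qed.

(** * Invariant convex subcones of the Tits cone *)

Section InvariantSubcone.
Variable Y : set dual.
Hypotheses (Y_tits : Y `<=` tits_cone H L).
Hypothesis Y_invariant : forall s, W s -> s @` Y `<=` Y.
Hypotheses (Y_cone : convex_cone Y) (Y_0 : Y 0).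
Hypothesis Y_faithful : forall s, W s -> (forall y, Y y -> s y = y) -> s = \1%VF.

Lemma subcone_orbit y : Y y ->
  exists s z, [/\ W s, Y z, closed_chamber H z & y = s z].
Proof.
move=> Yy; have [s Ws [z Cz szy]] := Y_tits Yy.
exists s, z; split=> //; apply: (Y_invariant (generated_inv Ws)).
by exists y => //; rewrite -szy lker0_lfunK//; exact: coxeter_group_ker0.
Qed.

(* [y - t alpha_i] lies on the segment from [y] to its mirror image. *)
Lemma subcone_sub_alpha y i (t : R) :
  Y y -> 0 <= t -> t <= coroot i y -> Y (y - t *: alpha i).
Proof.
move=> Yy t0; have [->|yi0] := eqVneq (coroot i y) 0.
  by move=> t0'; rewrite (_ : t = 0) ?scale0r ?subr0//; apply/eqP; rewrite eq_le t0 t0'.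
move=> ty; have yi : 0 < coroot i y by rewrite lt_def yi0 (le_trans t0).
have -> : y - t *: alpha i =
    (1 - t / coroot i y) *: y + (t / coroot i y) *: reflection i y.
  rewrite reflectionE scalerBr scalerA divfK// addrA -scalerDl.
  by rewrite subrK scale1r.
apply: (cone_add Y_cone); apply: (cone_scale Y_cone Y_0) => //.
- by rewrite subr_ge0 ler_pdivrMr// mul1r.
- by rewrite divr_ge0// ltW.
- by apply: (Y_invariant (reflection_in i)); exists y.
Qed.

Lemma subcone_sub_sum_alpha y (c : 'I_n -> R) : Y y -> (forall i, 0 <= c i) ->
  (forall i, n%:R * c i <= coroot i y) -> Y (y - \sum_i c i *: alpha i).
Proof.
move=> Yy c0 cy; have n0 : 0 < n%:R :> R by rewrite ltr0n; exact: lcs_rank lcs.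
have -> : y - \sum_i c i *: alpha i =
    n%:R^-1 *: \sum_i (y - (n%:R * c i) *: alpha i).
  rewrite sumrB sumr_const card_ord scalerBr -[y *+ n]scaler_nat scalerA mulVf ?gt_eqF//.
  rewrite scale1r scaler_sumr; congr (_ - _); apply: eq_bigr => i _.
  by rewrite scalerA mulKf// gt_eqF.
apply: (cone_scale Y_cone Y_0); first by rewrite invr_ge0 ltW.
apply: (cone_sum Y_cone Y_0) => i; apply: subcone_sub_alpha => //.
by rewrite mulr_ge0// ltW.
Qed.

(* If [h_i] vanished on [Y] intersected with the closed chamber, all the [h_k]
   with this property would vanish on [Y], which [sigma_i] would then fix. *)
Lemma faithful_coroot_pos i :
  exists y, [/\ Y y, closed_chamber H y & 0 < coroot i y].
Proof.
pose pos k := exists y, [/\ Y y, closed_chamber H y & 0 < coroot k y].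
suff : pos i by [].
(* The midpoint of y and sigma_j y works: h_j vanishes there, no other h_m decreases, and h_k
   strictly increases. *)
have pos_adj j k : pos j -> coroot k (alpha j) < 0 -> pos k.
  move=> [y [Yy /closed_chamberP Cy yj]] kj.
  exists (y - (coroot j y / 2) *: alpha j); split.
  - by apply: subcone_sub_alpha => //; lra.
  - apply/closed_chamberP => m; rewrite evB evZ.
    have [->|mj] := eqVneq m j; first by rewrite coroot_alpha; lra.
    have := Cy m; have : coroot m (alpha j) <= 0 by apply: coroot_alpha_le0; rewrite eq_sym.
    by nra.
  - rewrite evB evZ; have := Cy k; nra.
apply: contrapT => npos; apply: (@reflection_neq1 i).
apply: Y_faithful (reflection_in i) _ => y /subcone_orbit[s [z [Ws Yz Cz ->]]].
(* [N] is stable under every sigma_j: if [pos j] fails, sigma_j fixes l; otherwise [pos_adj] forces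
   alpha_j(h_k) = 0 whenever [pos k] fails. It holds at z, which lies in Y and in the closed
   chamber. *)
pose N (l : dual) := forall k, ~ pos k -> coroot k l = 0.
have Nsz : N (s z).
  apply/(coxeter_group_stable _ Ws) => [j l Nl k nk|k nk].
    rewrite coroot_reflection (Nl k nk) sub0r.
    have [pj|/(Nl j)->] := pselect (pos j); last by rewrite mul0r oppr0.
    suff -> : coroot k (alpha j) = 0 by rewrite mulr0 oppr0.
    apply/eqP; rewrite eq_le leNgt; apply/andP; split.
      rewrite -leNgt; apply: coroot_alpha_le0.
      by apply/eqP => jk; apply: nk; rewrite -jk.
    by rewrite leNgt; apply/negP => /(pos_adj _ _ pj).
  apply/eqP; rewrite eq_le (closed_chamberP z).1// andbT leNgt.
  by apply/negP => zk; apply: nk; exists z.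
by rewrite reflectionE Nsz// scale0r subr0.
Qed.

Lemma faithful_open_chamber : exists2 y, Y y & open_chamber H y.
Proof.
have /choice[y yP] i := faithful_coroot_pos i.
exists (\sum_i y i); first by apply: (cone_sum Y_cone Y_0) => i; case: (yP i).
apply/open_chamberP => i; rewrite ev_sum (bigD1 i)//= ltr_wpDr//.
  by apply: sumr_ge0 => k _; case: (yP k) => _ /closed_chamberP.
by case: (yP i).
Qed.

Lemma imaginary_base_sub :
  closed_in_vect (Y `&` closed_chamber H) ->
  forall l, dual_imaginary_base H alpha l -> Y (- l).
Proof.
move=> Y_closed _ [[c c0 ->] [l Cl lE]].
have {lE} lE : l = - \sum_i c i *: alpha i by rewrite -lE opprK.
rewrite -lE; move/closed_chamberP: Cl => Cl.
have [y Yy yc] : exists2 y, Y y & forall i, n%:R * c i <= coroot i y.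
  have [z Yz /open_chamberP Cz] := faithful_open_chamber.
  (* Scaling z by b_i suffices for the index i; the sum of these nonnegative factors serves all
     indices at once. *)
  pose b i := n%:R * c i / coroot i z.
  have b0 i : 0 <= b i by rewrite divr_ge0 ?mulr_ge0 ?ler0n// ltW.
  exists ((\sum_i b i) *: z).
    by apply: (cone_scale Y_cone Y_0) => //; exact: sumr_ge0.
  move=> i; rewrite evZ -ler_pdivrMr// -/(b i) (bigD1 i)//= lerDl.
  exact: sumr_ge0.
(* As l is nonnegative on each h_i, the bound n c_i <= y(h_i) persists at y + k l. *)
have Yyk (k : nat) : Y (y + k%:R *: l).
  elim: k => [|k IH]; first by rewrite scale0r addr0.
  rewrite -natr1 scalerDl scale1r addrA [X in _ + X]lE.
  apply: subcone_sub_sum_alpha => // i; rewrite evD evZ.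
  by apply: le_trans (yc i) _; rewrite lerDl mulr_ge0.
(* Closedness is known only for this intersection, so the approximating points must lie in the
   chamber too. *)
suff [] : (Y `&` closed_chamber H) l by [].
apply: (closed_in_vect_halfline (x := y) Y_closed) => k.
have -> : k.+1%:R^-1 *: y + l = k.+1%:R^-1 *: (y + k.+1%:R *: l).
  by rewrite scalerDr scalerA mulVf ?scale1r// pnatr_eq0.
have k0 : 0 <= k.+1%:R^-1 :> R by rewrite invr_ge0.
split; first exact: (cone_scale Y_cone Y_0).
apply/closed_chamberP => i; rewrite evZ evD evZ mulr_ge0// addr_ge0//.
  by apply: le_trans (yc i); rewrite mulr_ge0.
by rewrite mulr_ge0.
Qed.

End InvariantSubcone.

End CoxeterSystem.

Theorem corollary4p37 (R : realType) (h : vectType R) (n : nat)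
    (H : 'I_n -> set h) (L : 'I_n -> set 'Hom(h, R^o))
    (lcs : linear_coxeter_system H L)
    (hv : 'I_n -> h) (alpha : 'I_n -> 'Hom(h, R^o))
    (hv_H : forall i, H i (hv i)) (alpha_L : forall i, L i (alpha i))
    (alpha_hv : forall i, alpha i (hv i) = 2)
    (Y : set 'Hom(h, R^o))
    (Y_tits : Y `<=` tits_cone H L)
    (Y_invariant : forall s, coxeter_group H L s -> s @` Y `<=` Y)
    (Y_cone : convex_cone Y)
    (Y_0 : Y 0)
    (Y_faithful : forall s, coxeter_group H L s ->
       (forall y, Y y -> s y = y) -> s = \1%VF)
    (Y_closed : closed_in_vect (Y `&` closed_chamber H)) :
  [set - z | z in dual_imaginary_cone H L alpha] `<=` Y.
Proof.
(* Since -(s l) = s(-l), invariance of Y reduces the claim to l in the base of the dual imaginary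
   cone. *)
move=> _ [_ [s Ws [l Kl <-]] <-]; rewrite -linearN; apply: (Y_invariant s Ws).
exists (- l) => //.
exact: (imaginary_base_sub lcs hv_H alpha_L alpha_hv Y_tits).
Qed.
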